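(* Let $n\geq 10$ and let $T_n$ be a tree with $n$ vertices that is not isomorphic to the path $P_n$. Let $p$ be a positive real number. (i) If $p>1$, then $A_p(T_n)\geq 6^{\frac{1}{p}}$, with equality if and only if $T_n$ is a spider with maximum degree $3$ all of whose three legs have length at least $2$. (ii) If $p=1$, then $A_p(T_n)\geq 6$, with equality if and only if $T_n$ is a spider with maximum degree $3$. (iii) If $0<p<1$, then $A_p(T_n)\geq (2^{p+1}+2)^{\frac{1}{p}}$, with equality if and only if $T_n$ is the spider with maximum degree $3$ whose legs have lengths $1$, $1$ and $n-3$.
   Context: $d(v)$ is the degree of vertex $v$. For a positive real number $p$, the general Albertson irregularity index of a connected graph $G$ is $A_p(G)=\left(\sum_{uv\in E(G)}|d(u)-d(v)|^p\right)^{1/p}$. A spider is a tree with at most one vertex of degree more than two. For a spider with maximum degree $3$, its legs are the three paths from the unique vertex of degree $3$ to the pendant vertices (vertices of degree one), and the length of a leg is its number of edges. *)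

(* Defs.v *)
From mathcomp Require Import all_boot all_order all_algebra.
From mathcomp Require Import all_classical all_reals all_analysis.

Set Implicit Arguments.
Unset Strict Implicit.
Unset Printing Implicit Defensive.

Import Order.TTheory GRing.Theory Num.Theory.

Local Open Scope ring_scope.

Definition simple_graph (V : finType) (e : rel V) : Prop :=
  symmetric e /\ irreflexive e.

Definition connected_graph (V : finType) (e : rel V) : Prop :=
  (0 < #|V|)%N /\ forall u v : V, connect e u v.

(* Closed vertex sequences of size at most 2 do not count as cycles: a single
   edge xy makes [:: x; y] a ucycle. *)
Definition acyclic (V : finType) (e : rel V) : Prop :=
  forall c : seq V, ucycle e c -> (size c <= 2)%N.

Definition is_tree (V : finType) (e : rel V) : Prop :=
  [/\ simple_graph e, connected_graph e & acyclic e].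

Definition graph_iso (V W : finType) (e : rel V) (e' : rel W) : Prop :=
  exists f : V -> W, bijective f /\ forall u v : V, e' (f u) (f v) = e u v.

Definition path_graph (n : nat) : rel 'I_n :=
  fun i j => (i.+1 == j :> nat) || (j.+1 == i :> nat).

Definition degree (V : finType) (e : rel V) (v : V) : nat :=
  #|[set u | e v u]|.

Definition max_degree (V : finType) (e : rel V) : nat :=
  (\max_(v : V) degree e v)%N.

(* The condition on enum_rank selects exactly one of the two orientations of
   each edge, so that the sum ranges over unordered edges. *)
Definition albertson (R : realType) (V : finType) (e : rel V) (p : R) : R :=
  (\sum_(uv : V * V | e uv.1 uv.2 && (enum_rank uv.1 < enum_rank uv.2)%N)
      `|(degree e uv.1)%:R - (degree e uv.2)%:R| `^ p) `^ (1 / p).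

Definition is_spider (V : finType) (e : rel V) : Prop :=
  is_tree e /\
  forall u v : V, (2 < degree e u)%N -> (2 < degree e v)%N -> u = v.

Definition is_spider3 (V : finType) (e : rel V) : Prop :=
  is_spider e /\ max_degree e = 3%N.

(* l lists the vertices of the leg other than the centre c, so that size l is
   the number of edges of the leg. *)
Definition is_leg (V : finType) (e : rel V) (c : V) (l : seq V) : bool :=
  [&& degree e c == 3%N, path e c l, uniq (c :: l)
    & degree e (last c l) == 1%N].

Definition leg_lengths (V : finType) (e : rel V) (s : seq nat) : Prop :=
  exists (c : V) (ls : seq (seq V)),
    [/\ uniq ls, forall l : seq V, (l \in ls) = is_leg e c l
      & perm_eq (map size ls) s].

(* Main.v *)
(** Let L, M, B be the sets of vertices of degree 1, 2 and at least 3, and let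
    a, b, c be the numbers of edges of type L-B, L-M and M-B.  Since the tree
    is not a path, B is nonempty.  A connected graph has at least |V \ A| edges
    touching the complement of a nonempty set A; applied to A = B this gives
    b <= c, and applied to A = M + B it shows that leaves are not adjacent, so
    that a + b = |L|.  As t |-> t^p is increasing, the edges of these three types
    contribute at least 2^p a + b + c >= 2^p a + 2 b to A_p^p.  The degree sum
    2(n - 1) gives |L| = 2 + sum_B (d - 2) >= 3, with equality exactly for
    spiders of maximum degree 3.  For such a spider A_p^p is exactly
    2^p a + 2(3 - a), where a is the number of legs of length 1, and otherwise
    a + b >= 4; it remains to compare 2^p with 2. *)

Require Import Defs.
From mathcomp Require Import all_boot all_order all_algebra.
From mathcomp Require Import all_classical all_reals all_analysis.
From mathcomp Require Import zify ring lra.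

Set Implicit Arguments.
Unset Strict Implicit.
Unset Printing Implicit Defensive.

Import Order.TTheory GRing.Theory Num.Theory.

Local Open Scope ring_scope.

(** * Adjacent pairs inside a vertex set: connected and acyclic bounds *)

(* Ordered pairs of adjacent vertices: an edge inside A counts twice in
   [darts e A A]. *)
Definition darts (V : finType) (e : rel V) (A B : {set V}) : nat :=
  (\sum_(u in A) \sum_(v in B) e u v)%N.

Definition degree_class (V : finType) (e : rel V) (k : nat) : {set V} :=
  [set v | degree e v == k].

Definition branching (V : finType) (e : rel V) : {set V} :=
  [set v | (2 < degree e v)%N].

Section Graph.
Variables (V : finType) (e : rel V).

Lemma dartsC (A B : {set V}) : symmetric e -> darts e A B = darts e B A.
Proof.
move=> sym; rewrite /darts exchange_big /=.
by apply: eq_bigr => u _; apply: eq_bigr => v _; rewrite sym.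
Qed.

Lemma darts_setU1l (v : V) (A B : {set V}) : v \notin A ->
  darts e (v |: A) B = (\sum_(w in B) e v w + darts e A B)%N.
Proof. by move=> vA; rewrite /darts big_setU1. Qed.

Lemma darts_setU1 (v : V) (A : {set V}) : symmetric e -> irreflexive e ->
  v \notin A ->
  darts e (v |: A) (v |: A) = (darts e A A + 2 * \sum_(w in A) e v w)%N.
Proof.
move=> sym irr vA.
rewrite darts_setU1l // big_setU1 //= irr add0n.
rewrite dartsC // darts_setU1l //; lia.
Qed.

Lemma degreeE (v : V) : degree e v = (\sum_w e v w)%N.
Proof. by rewrite /degree cardsE -sum1_card big_mkcond. Qed.

Lemma connected_closed (A : {set V}) (x : V) : connected_graph e ->
  x \in A -> (forall u v, u \in A -> e u v -> v \in A) -> forall v, v \in A.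
Proof.
move=> [_ con] xA cl v; case/connectP: (con x v) => p.
elim: p x xA => [|y p IH] x xA /=; first by move=> _ ->.
by case/andP => exy; apply: IH; apply: cl exy.
Qed.

(* Enlarge A one vertex at a time, along an edge leaving A: each step adds at
   least two darts. *)
Lemma darts_grow (A : {set V}) (x : V) : symmetric e -> irreflexive e ->
  connected_graph e -> x \in A ->
  (darts e A A + 2 * #|~: A| <= darts e [set: V] [set: V])%N.
Proof.
move=> sym irr con.
have [k] := ubnP #|~: A|; elim: k A => // k IH A lek xA.
have [full|/forallPn[w wA]] := boolP [forall v, v \in A].
  have -> : A = [set: V].
    by apply/setP => v; rewrite inE (forallP full).
  by rewrite finset.setCT cards0; lia.
have [[u [v [uA vA euv]]]|no] :=
    pselect (exists u v, [/\ u \in A, v \notin A & e u v]); last first.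
  case/negP: wA; apply: (connected_closed con xA) => u v uA euv.
  by apply/negPn/negP => vA; apply: no; exists u, v.
have card : #|~: A| = #|~: (v |: A)|.+1.
  rewrite (cardsD1 v (~: A)) inE vA finset.setCU finset.setIC -finset.setDE; lia.
have := IH (v |: A); rewrite darts_setU1 // inE xA orbT => /(_ _ isT).
have : (0 < \sum_(w in A) e v w)%N.
  by rewrite (bigD1 u) //= sym euv.
lia.
Qed.

(** The segment of the path from [x] to [y], closed by the chord, is a cycle; it therefore has at
    most two vertices, and [y] comes right after [x]. *)
Lemma acyclic_chord (x y : V) (p : seq V) : acyclic e -> symmetric e ->
  path e x p -> uniq (x :: p) -> y \in p -> e x y -> y = head x p.
Proof.
move=> acy sym xp unq yp exy.
case/splitPr: yp xp unq => p1 p2.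
rewrite -cat_rcons cat_path -cat_cons cat_uniq => /andP[xp1 _] /andP[unq _].
have := acy (x :: rcons p1 y).
rewrite /ucycle /cycle rcons_path xp1 last_rcons sym exy unq /= size_rcons.
by move/(_ isT); case: p1 {xp1 unq}.
Qed.

(** Duplicate-free sequences have size at most [#|V|], so lengthening must stop. It serves to pick
    longest paths. *)
Lemma ex_longest (P : seq V -> Prop) (s0 : seq V) : P s0 ->
  (forall s, P s -> uniq s) ->
  exists s, P s /\ forall t, P t -> (size t <= size s)%N.
Proof.
move=> Ps0 unq.
have [k] := ubnP (#|V| - size s0); elim: k s0 Ps0 => // k IH s Ps lek.
have [[t [Pt lt]]|no] := pselect (exists t, P t /\ (size s < size t)%N).
  apply: (IH t Pt); have := max_card (mem t).
  rewrite (card_uniqP (unq _ Pt)); lia.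
exists s; split=> // t Pt; rewrite leqNgt; apply/negP => lt.
by apply: no; exists t.
Qed.

(* The first vertex of a longest path in A works. *)
Lemma acyclic_low_degree (A : {set V}) (x0 : V) : acyclic e -> symmetric e ->
  irreflexive e ->
  x0 \in A -> exists2 v, v \in A & (\sum_(w in A) e v w <= 1)%N.
Proof.
move=> acy sym irr x0A.
pose P s := if s is x :: p then
  [&& path e x p, uniq s & all (mem A) s] else false.
have [| |s [Ps max]] := @ex_longest P [:: x0].
- by rewrite /P /= x0A.
- by case=> //= x p /and3P[].
case: s Ps max => // x p /and3P[xp unq allA] max.
exists x; first by case/andP: allA.
(* By maximality a neighbour of [x] in [A] lies on the path; it is then the second vertex, since a
   later one would close a cycle. *)
have nb w : w \in A -> e x w -> w = head x p.
  move=> wA exw; have [wp|wp] := boolP (w \in x :: p).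
    move: wp; rewrite inE => /orP[/eqP wx|wp]; first by rewrite wx irr in exw.
    exact: acyclic_chord wp exw.
  suff /max : P (w :: x :: p) by rewrite /= ltnn.
  apply/and3P; split; first by rewrite /= sym exw.
    by rewrite cons_uniq wp.
  by apply/andP.
rewrite (eq_bigr (fun w => (w == head x p) && e x w : nat)); last first.
  by move=> w wA; case: (boolP (e x w)) => [/(nb _ wA) -> | _];
    rewrite ?eqxx ?andbF.
apply: (@leq_trans (\sum_(w in A) (w == head x p))).
  by apply: leq_sum => w _; case: (w == _) => //; case: (e x w).
rewrite big_mkcond (bigD1 (head x p)) //= big1 => [|w /negPf ->].
  by rewrite eqxx; case: ifP.
by case: ifP.
Qed.

(** Removing a vertex with at most one neighbour in [A] costs at most two darts, and a single vertex
    has none. *)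
Lemma darts_forest (A : {set V}) (x : V) : acyclic e -> symmetric e ->
  irreflexive e -> x \in A -> (darts e A A + 2 <= 2 * #|A|)%N.
Proof.
move=> acy sym irr.
have [k] := ubnP #|A|; elim: k A x => // k IH A x lek xA.
have [v vA dv] := acyclic_low_degree acy sym irr xA.
have E : A = v |: (A :\ v) by rewrite finset.setD1K.
have vA' : v \notin A :\ v by rewrite !inE eqxx.
have cA : #|A| = #|A :\ v|.+1 by rewrite (cardsD1 v) vA.
have [A0|] := posnP #|A :\ v|; last first.
  move=> /card_gt0P[y yA].
  have := IH _ _ _ yA; rewrite E darts_setU1 // -E.
  have : (\sum_(w in A :\ v) e v w <= \sum_(w in A) e v w)%N.
    by rewrite [X in (_ <= X)%N](big_setD1 v) //= leq_addl.
  lia.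
rewrite E darts_setU1 // -E cA A0.
move/eqP: A0; rewrite cards_eq0 => /eqP ->.
by rewrite /darts !big_set0.
Qed.

Lemma darts_setUl (A B C : {set V}) : [disjoint A & B] ->
  darts e (A :|: B) C = (darts e A C + darts e B C)%N.
Proof.
move=> dis; rewrite /darts -bigU //.
by apply: eq_bigl => v; rewrite !inE.
Qed.

(** * Paths, neighbours and degrees *)

Lemma size_neighbours (v : V) (s : seq V) : uniq s -> all (e v) s ->
  (size s <= degree e v)%N.
Proof.
move=> unq /allP nb; rewrite -(card_uniqP unq) /degree.
by apply/subset_leq_card/fintype.subsetP => w /nb; rewrite inE.
Qed.

Lemma path_nth (x v w : V) (p : seq V) : path e x p ->
  v \in x :: p -> w \in x :: p ->
  (index v (x :: p)).+1 = index w (x :: p) -> e v w.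
Proof.
move=> xp vs ws iE; move/(pathP x)/(_ (index v (x :: p))): xp.
have lt : (index v (x :: p) < size p)%N.
  by move: ws; rewrite -index_mem -iE.
move/(_ lt); rewrite nth_index //.
have -> : nth x p (index v (x :: p)) = nth x (x :: p) (index v (x :: p)).+1 by [].
by rewrite iE nth_index.
Qed.

(** Induction along the path: if [v] is the first vertex, the edge is a chord from the start;
    otherwise the first vertex is dropped. *)
Lemma acyclic_index (x v w : V) (p : seq V) : acyclic e -> symmetric e ->
  path e x p -> uniq (x :: p) -> v \in x :: p -> w \in x :: p -> e v w ->
  (index v (x :: p) < index w (x :: p))%N ->
  (index v (x :: p)).+1 = index w (x :: p).
Proof.
move=> acy sym; elim: p x => [|y p IH] x.
  by move=> _ _; rewrite !inE => /eqP -> /eqP ->; rewrite ltnn.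
move=> xp unq vs ws evw; rewrite /= (eq_sym x v) (eq_sym x w).
have [wx|wx] := eqVneq w x; first by rewrite ltn0.
have wp : w \in y :: p by move: ws; rewrite inE (negPf wx).
have [vx|vx] := eqVneq v x => lt.
  rewrite vx in evw; have /= -> := acyclic_chord acy sym xp unq wp evw.
  by rewrite eqxx.
have vp : v \in y :: p by move: vs; rewrite inE (negPf vx).
by move: xp unq => /andP[_ yp] /andP[_ unq]; congr _.+1; apply: IH.
Qed.

Lemma connected_degree_gt0 (v : V) : connected_graph e -> (1 < #|V|)%N ->
  (0 < degree e v)%N.
Proof.
move=> con gt1; rewrite lt0n; apply: contraL gt1 => /eqP d0.
have cl : forall w, w \in [set v].
  apply: (@connected_closed [set v] v con); first by rewrite inE.
  move=> u w; rewrite !inE => /eqP -> evw.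
  have := @size_neighbours v [:: w] isT; rewrite /= evw d0 => /(_ isT).
  by [].
rewrite -leqNgt -(cards1 v); apply/subset_leq_card/fintype.subsetP => w _.
exact: cl.
Qed.

(** * Edge counts between the degree classes of a tree *)

Lemma sum_by_degree (F : V -> nat) : (forall v, 0 < degree e v)%N ->
  (\sum_v F v = \sum_(v in degree_class e 1) F v
     + \sum_(v in degree_class e 2) F v + \sum_(v in branching e) F v)%N.
Proof.
move=> gt0; rewrite (big_mkcond (fun v => v \in degree_class e 1)).
rewrite (big_mkcond (fun v => v \in degree_class e 2)).
rewrite (big_mkcond (fun v => v \in branching e)) -!big_split /=.
apply: eq_bigr => v _; rewrite !inE.
by have := gt0 v; case: (degree e v) => [|[|[|]]]//= *; rewrite ?addn0.
Qed.

Lemma darts_by_degree (A : {set V}) : (forall v, 0 < degree e v)%N ->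
  (\sum_(v in A) degree e v = darts e A (degree_class e 1)
     + darts e A (degree_class e 2) + darts e A (branching e))%N.
Proof.
move=> gt0; rewrite /darts -!big_split /=; apply: eq_bigr => v _.
by rewrite degreeE sum_by_degree.
Qed.

Lemma sum_degree_class (k : nat) :
  (\sum_(v in degree_class e k) degree e v = k * #|degree_class e k|)%N.
Proof.
rewrite mulnC -sum_nat_const; apply: eq_bigr => v.
by rewrite inE => /eqP.
Qed.

(** The linear relations from which the later counts follow by arithmetic. [card_leaves] carries the
    fact that no two leaves are adjacent. *)
Record tree_counts : Prop := TreeCounts {
  card_by_degree :
    (#|degree_class e 1| + #|degree_class e 2| + #|branching e| = #|V|)%N;
  card_leaves :
    (#|degree_class e 1| = darts e (degree_class e 1) (degree_class e 2)
       + darts e (degree_class e 1) (branching e))%N;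
  branching_degrees :
    (\sum_(v in branching e) degree e v + 2
       = #|degree_class e 1| + 2 * #|branching e|)%N;
  leaf_darts_le :
    (darts e (degree_class e 1) (degree_class e 2)
       <= darts e (degree_class e 2) (branching e))%N;
  branching_darts :
    (\sum_(v in branching e) degree e v
      = darts e (degree_class e 1) (branching e)
        + darts e (degree_class e 2) (branching e)
        + darts e (branching e) (branching e))%N;
  card_degree2 :
    (2 * #|degree_class e 2| = darts e (degree_class e 1) (degree_class e 2)
        + darts e (degree_class e 2) (degree_class e 2)
        + darts e (degree_class e 2) (branching e))%N
  }.

Lemma tree_countsP (b : V) : is_tree e -> b \in branching e -> tree_counts.
Proof.
move=> [[sym irr] con acy] bB.
have gt1 : (1 < #|V|)%N.
  have : (2 < degree e b)%N by move: bB; rewrite inE.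
  rewrite /degree => lt; apply: leq_trans (max_card _); apply: ltnW lt.
have gt0 v : (0 < degree e v)%N := connected_degree_gt0 v con gt1.
set L := degree_class e 1; set M := degree_class e 2; set B := branching e.
have cV : #|V| = (#|L| + #|M| + #|B|)%N.
  by have := sum_by_degree (fun=> 1%N) gt0; rewrite !sum1_card.
have dV : darts e [set: V] [set: V] = (#|L| + 2 * #|M| + \sum_(v in B) degree e v)%N.
  rewrite -(mul1n #|L|) -!sum_degree_class -sum_by_degree // /darts.
  rewrite [LHS](eq_bigl xpredT) => [|v]; last by rewrite inE.
  by apply: eq_bigr => v _; rewrite degreeE; apply: eq_bigl => w; rewrite inE.
have dL := sum_degree_class 1; rewrite darts_by_degree // -/L -/M -/B in dL.
have dM := sum_degree_class 2; rewrite darts_by_degree // -/L -/M -/B in dM.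
have dB := darts_by_degree B gt0; rewrite -/L -/M -/B in dB.
have ML := dartsC M L sym; have BL := dartsC B L sym.
have BM := dartsC B M sym.
(* [up] and [lo] together give exactly [2 * #|V| - 2] darts, the degree sum of a tree. *)
have up := darts_forest acy sym irr (finset.in_setT b); rewrite cardsT in up.
have lo := darts_grow sym irr con (finset.set11 b).
have c1 := cardsC [set b]; rewrite cards1 in c1.
(* Once degrees are expanded, [gB] bounds [#|L|] by the L-B and M-B edges, whence [leaf_darts_le];
   [gMB] bounds it by the L-B and L-M edges, so no dart is left inside [L]. *)
have gB := darts_grow sym irr con bB; rewrite -/B in gB.
have cB := cardsC B.
have bMB : b \in M :|: B by rewrite inE bB orbT.
have gMB := darts_grow sym irr con bMB; have cMB := cardsC (M :|: B).
have dis : [disjoint M & B].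
  by rewrite disjoint_subset; apply/fintype.subsetP => v; rewrite !inE => /eqP ->.
have cMB' : #|M :|: B| = (#|M| + #|B|)%N.
  by apply/eqP; rewrite (leq_card_setU M B).
have dMB : darts e (M :|: B) (M :|: B) =
    (darts e M M + 2 * darts e M B + darts e B B)%N.
  rewrite darts_setUl // dartsC // darts_setUl // [darts e B (_ :|: _)]dartsC //.
  by rewrite darts_setUl // BM; lia.
split; rewrite -/L -/M -/B; lia.
Qed.

(** * Trees without branching vertices are paths *)

(* A longest path covers all vertices; acyclicity excludes further edges. *)
Lemma degree_le2_path (n : nat) : is_tree e -> #|V| = n ->
  (forall v, degree e v <= 2)%N -> graph_iso e (@path_graph n).
Proof.
move=> [[sym irr] con acy] cV deg.
have /card_gt0P[x0 _] := con.1.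
have [| |s [/andP[us es] max]] := @ex_longest (fun s => uniq s && sorted e s) [:: x0].
- by [].
- by move=> s /andP[].
have s_full v : v \in s.
  case: s us es max => [|x p] us es max; first by have := max [:: x0] isT.
  suff : forall w, w \in [set u in x :: p] by move/(_ v); rewrite inE.
  apply: (@connected_closed _ x con); first by rewrite !inE eqxx.
  move=> {}v w; rewrite ![_ \in [set _ in _]]inE => vs evw.
  (* A neighbour [w] of [v] off the path is impossible: if [v] is an end of the path, [w] extends
     it, against [max]; otherwise [v] has the three neighbours [a], [b] and [w]. *)
  apply/negPn/negP => ws.
  case/splitPr: vs us es max ws => s1 s2; case/lastP: s1 => [|s1 a] us es max ws.
    have := max (w :: v :: s2); rewrite /= sym evw /= ltnn.
    by move: us es ws => /= -> -> ->; move/(_ isT).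
  rewrite cat_rcons in us es ws max.
  have /andP[eav es2] : e a v && path e v s2.
    by have [_ /=] := cat_sorted2 es.
  case: s2 us es max ws es2 => [|b s2] us es max ws es2.
    set t := s1 ++ [:: a; v] in us es ws max.
    suff /max : uniq (t ++ [:: w]) && sorted e (t ++ [:: w]).
      by rewrite size_cat /=; lia.
    rewrite cat_uniq us /= orbF ws /=.
    move: es; rewrite /t; case: (s1) => [|y s] /=; first by rewrite evw !andbT.
    by rewrite !cat_path last_cat /= evw => /andP[-> ->].
  move: es2 => /= /andP[evb _].
  have := deg v; rewrite leqNgt => /negP; apply.
  apply: (@size_neighbours v [:: a; b; w]); last by rewrite /= sym eav evb evw.
  have : uniq [:: a, v, b & s2] by move: us; rewrite cat_uniq => /and3P[].
  move: ws; rewrite mem_cat !inE !negb_or => /andP[_ /and4P[wa _ wb _]].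
  rewrite /= !inE !negb_or => /andP[/and3P[_ ab _] _].
  by rewrite ab (eq_sym a) wa (eq_sym b) wb.
have size_s : size s = n.
  by rewrite -cV -(card_uniqP us); apply: eq_card => v; rewrite s_full.
have lt v : (index v s < n)%N by rewrite -size_s index_mem.
exists (fun v => Ordinal (lt v)); split.
  apply: inj_card_bij; last by rewrite card_ord cV.
  by move=> u v [] /(index_inj x0 (s_full u) (s_full v)).
move=> u v; rewrite /path_graph /=.
case: s us es s_full {max size_s lt} => [|x p] us es s_full.
  by have := s_full u.
apply/idP/idP => [/orP[]/eqP iE|euv].
- exact: (path_nth es) iE.
- by rewrite sym; apply: (path_nth es) iE.
have [lt|lt|iE] := ltngtP (index u (x :: p)) (index v (x :: p)).
- by rewrite (acyclic_index acy sym es us _ _ euv lt) ?eqxx.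
- by rewrite sym in euv; rewrite (acyclic_index acy sym es us _ _ euv lt) ?eqxx ?orbT.
by move: euv; rewrite (index_inj x0 (s_full u) (s_full v) iE) irr.
Qed.

Lemma not_path_branching (n : nat) : is_tree e -> #|V| = n ->
  ~ graph_iso e (@path_graph n) -> exists b, b \in branching e.
Proof.
move=> tr cV np.
have [/existsP//|/existsPn no] := boolP [exists b, b \in branching e].
case: np; apply: degree_le2_path => // v.
by have := no v; rewrite inE -leqNgt.
Qed.

(** * Spiders of maximum degree three and their leaves *)

Lemma spider3P : is_tree e ->
  is_spider3 e <-> exists c, branching e = [set c] /\ degree e c = 3%N.
Proof.
move=> tr; split=> [[[_ one] mx]|[c [cB c3]]].
  have /card_gt0P[x0 _] : (0 < #|V|)%N by case: tr => _ [].
  have [|c cE] := @bigop.eq_bigmax V (degree e); first by apply/card_gt0P; exists x0.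
  have c3 : degree e c = 3%N by rewrite -cE.
  exists c; split=> //; apply/setP => v; rewrite !inE.
  apply/idP/eqP => [v3|->]; last by rewrite c3.
  by apply: one; rewrite ?c3.
have le3 v : (2 < degree e v)%N -> v = c.
  by move=> v3; apply/set1P; rewrite -cB inE.
split; first by split=> // u v /le3 -> /le3 ->.
apply/eqP; rewrite /max_degree eqn_leq -{2}c3 bigop.leq_bigmax andbT.
apply/bigop.bigmax_leqP => v _; have [/le3 ->|] := boolP (2 < degree e v)%N.
  by rewrite c3.
lia.
Qed.

(** Each branching vertex contributes [d - 2 >= 1] to [#|L| - 2], so three leaves mean a single
    branching vertex, of degree 3. *)
Lemma spider3_leaves (b : V) : is_tree e -> b \in branching e ->
  (3 <= #|degree_class e 1|)%N
  /\ (is_spider3 e <-> #|degree_class e 1| = 3%N).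
Proof.
move=> tr bB; have T := tree_countsP tr bB.
have lo : (3 * #|branching e| <= \sum_(v in branching e) degree e v)%N.
  rewrite mulnC -sum_nat_const; apply: leq_sum => v; by rewrite inE.
have B0 : (0 < #|branching e|)%N by apply/card_gt0P; exists b.
have bd := branching_degrees T.
split; first by lia.
rewrite spider3P //; split=> [[c [cB c3]]|L3].
  by move: bd; rewrite cB big_set1 cards1 c3; lia.
have /eqP/cards1P[c cB] : #|branching e| = 1%N by lia.
exists c; split=> //; move: bd; rewrite cB big_set1 cards1 L3; lia.
Qed.

(** * Legs of a spider *)

(** A leg is determined by its first vertex: at degree at most 2 there is only one way to go on
    without turning back, and at degree 1 there is none. *)
Lemma leg_unique (c w : V) (t t' : seq V) : symmetric e ->
  path e c (w :: t) -> path e c (w :: t') ->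
  uniq [:: c, w & t] -> uniq [:: c, w & t'] ->
  {in w :: t, forall v, degree e v <= 2}%N ->
  degree e (last w t) = 1%N -> degree e (last w t') = 1%N -> t = t'.
Proof.
move=> sym; elim: t c w t' => [|a t IH] c w [|b t'] //=.
- move=> _ /and3P[cw wb _] _ /andP[]; rewrite !inE !negb_or => /and3P[_ cb _] _ _ d1.
  have := @size_neighbours w [:: c; b]; rewrite d1 /= inE cb sym cw wb.
  by move=> /(_ isT isT).
- move=> /and3P[cw wa _] _ /andP[]; rewrite !inE !negb_or => /and3P[_ ca _] _ _ _ _ d1.
  have := @size_neighbours w [:: c; a]; rewrite d1 /= inE ca sym cw wa.
  by move=> /(_ isT isT).
move=> /and3P[cw wa pt] /and3P[_ wb pt'] /andP[ct ut] /andP[ct' ut'] deg d d'.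
have ab : b = a.
  apply/eqP/negPn/negP => ba.
  have := deg w (mem_head _ _); rewrite leqNgt => /negP; apply.
  apply: (@size_neighbours w [:: c; a; b]); last by rewrite /= sym cw wa wb.
  move: ct ct'; rewrite /= !inE !negb_or => /and3P[_ -> _] /and3P[_ -> _].
  by rewrite eq_sym ba.
rewrite {}ab in wb pt' ut' d' *; congr (_ :: _).
apply: (IH w a) => //=; rewrite ?wa //.
by move=> v vt; apply: deg; rewrite inE vt orbT.
Qed.

(** The predecessor and, except at the end, the successor on the leg already use up the degree of
    [v]. *)
Lemma leg_closed (c u v : V) (l : seq V) : symmetric e -> path e c l ->
  uniq (c :: l) -> {in l, forall v, degree e v <= 2}%N ->
  degree e (last c l) = 1%N -> v \in l -> e v u -> u \in c :: l.
Proof.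
move=> sym; elim: l c => [|w t IH] c //= /andP[cw wt] /andP[ct ut] deg d1.
rewrite in_cons => /orP[/eqP ->|vt] evu; last first.
  rewrite inE; apply/orP; right; apply: (IH w) => // z zt.
  by apply: deg; rewrite inE zt orbT.
case: t wt ut deg d1 ct {IH} => [|a t] wt ut deg d1 ct.
  have [->|uc] := eqVneq u c; first by rewrite mem_head.
  have := @size_neighbours w [:: u; c]; rewrite /= in d1.
  by rewrite d1 /= inE uc evu sym cw => /(_ isT isT).
move: wt => /= /andP[wa _]; rewrite !inE.
apply/negPn/negP; rewrite !negb_or => /and4P[uc uw ua _].
have := deg w (mem_head _ _); rewrite leqNgt => /negP; apply.
apply: (@size_neighbours w [:: u; c; a]); last by rewrite /= evu sym cw wa.
by move: ct; rewrite /= !inE !negb_or uc ua => /and3P[_ -> _].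
Qed.

(** For the centre [c] of a spider these are the ends of the legs of length 1. *)
Definition pendant_neighbours (c : V) : {set V} :=
  [set u in degree_class e 1 | e u c].

Lemma card_pendant_neighbours (c : V) : branching e = [set c] ->
  darts e (degree_class e 1) (branching e) = #|pendant_neighbours c|.
Proof.
move=> ->; rewrite -sum1_card /darts (big_mkcond (mem (pendant_neighbours c))).
rewrite (big_mkcond (fun u => u \in degree_class e 1)) /=.
apply: eq_bigr => u _; rewrite big_set1 !inE.
by case: (degree e u == 1%N); case: (e u c).
Qed.

Lemma is_leg1 (c u : V) : symmetric e -> irreflexive e -> degree e c = 3%N ->
  is_leg e c [:: u] = (u \in pendant_neighbours c).
Proof.
move=> sym irr c3; rewrite /is_leg c3 !inE /= !andbT sym andbC.
have [->|] := eqVneq c u; first by rewrite irr !andbF.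
by rewrite inE => ->.
Qed.

(** Legs of length 1 correspond to pendant neighbours of [c]; an empty leg would end at the centre,
    whose degree is 3 and not 1. *)
Lemma legs_ge2P (c : V) : symmetric e -> irreflexive e ->
  branching e = [set c] -> degree e c = 3%N ->
  (forall c l, is_leg e c l -> 2 <= size l)%N <->
  darts e (degree_class e 1) (branching e) = 0%N.
Proof.
move=> sym irr cB c3; rewrite (card_pendant_neighbours cB); split=> [legs|no c' l].
  apply: eq_card0 => u; apply/negP; rewrite -is_leg1 // => /legs.
  by [].
case: l => [|u [|//]] leg; have /and4P[/eqP c'3 _ _ /= d1] := leg.
  by rewrite c'3 in d1.
have /set1P c'c : c' \in [set c] by rewrite -cB inE c'3.
by rewrite c'c is_leg1 // (card0_eq no) in leg.
Qed.

(** The pendant neighbours are counted by the entries 1 of the length list; [n != 4] keeps [n - 3]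
    from being a third such entry. *)
Lemma leg_lengths_pendant (n : nat) (c : V) : symmetric e -> irreflexive e ->
  branching e = [set c] -> degree e c = 3%N -> n != 4 ->
  leg_lengths e [:: 1%N; 1%N; (n - 3)%N] -> #|pendant_neighbours c| = 2%N.
Proof.
move=> sym irr cB c3 n4 [c' [ls [uls lsP sizes]]].
have c'c : c' = c.
  case: ls lsP sizes {uls} => [|l ls] lsP sizes; first by have := perm_size sizes.
  have := mem_head l ls; rewrite lsP => /and4P[/eqP c'3 _ _ _].
  by apply/set1P; rewrite -cB inE c'3.
rewrite {}c'c in lsP.
have : perm_eq [seq l <- ls | size l == 1%N]
    [seq [:: u] | u <- enum (pendant_neighbours c)].
  apply: uniq_perm; first exact: filter_uniq.
    by rewrite map_inj_uniq ?enum_uniq // => u v [].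
  move=> l; rewrite mem_filter lsP; apply/andP/mapP => [[]|[u uP ->]].
    by case: l => [|u [|]] // _; rewrite is_leg1 // => uP; exists u; rewrite ?mem_enum.
  by rewrite is_leg1 // -mem_enum.
move/perm_size; rewrite size_map -cardE => <-.
rewrite size_filter -(count_map size (pred1 1%N)) (permP sizes) /=.
by have -> : (n - 3 == 1)%N = false by lia.
Qed.

(** Two legs are the pendant neighbours [x] and [y]; the third is a path from [c] to the remaining
    leaf [z], and it contains every vertex other than [c], [x], [y]. *)
Lemma pendant_leg_lengths (c : V) : is_tree e ->
  branching e = [set c] -> degree e c = 3%N -> #|degree_class e 1| = 3%N ->
  #|pendant_neighbours c| = 2%N ->
  leg_lengths e [:: 1%N; 1%N; (#|V| - 3)%N].
Proof.
move=> [[sym irr] con acy] cB c3 L3 P2.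
have /cards2P[x [y [xy Pxy]]] : #|pendant_neighbours c| == 2%N by rewrite P2.
have legx : is_leg e c [:: x] by rewrite is_leg1 // Pxy !inE eqxx.
have legy : is_leg e c [:: y] by rewrite is_leg1 // Pxy !inE eqxx orbT.
have [z zL zP] : exists2 z, z \in degree_class e 1 & z \notin pendant_neighbours c.
  by apply/subsetPn; apply: contraT => /negPn/subset_leq_card; rewrite L3 P2.
have deg v : v != c -> (degree e v <= 2)%N.
  move=> vc; rewrite leqNgt; apply: contra vc => v3.
  by apply/eqP/set1P; rewrite -cB inE.
have unique h t t' : is_leg e c (h :: t) -> is_leg e c (h :: t') -> t = t'.
  move=> /and4P[_ p u0 /eqP d] /and4P[_ p' u0' /eqP d'].
  apply: (leg_unique sym p p' u0 u0' _ d d') => // v vt; apply: deg.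
  by apply: contraTneq vt => ->; case/andP: u0.
have /connectP[l0 p0] := con.2 c z; case/shortenP: p0 => l pl ul _ lz {l0}.
have legl : is_leg e c l.
  by rewrite /is_leg c3 pl ul -lz; rewrite inE in zL.
case: l pl ul lz legl => [|h t] pl ul lz legl.
  by case/and4P: legl => _ _ _; rewrite /= c3.
(* Were [h] a pendant neighbour [u], uniqueness of legs would make [t] empty and [z] equal to [u],
   against the choice of [z]. *)
have hP u : u \in pendant_neighbours c -> h != u.
  move=> uP; apply/eqP => hu; move: legl uP; rewrite hu => legl uP.
  have := uP; rewrite -is_leg1 // => /unique/(_ legl) t0.
  by move: zP; rewrite lz -t0 /= hu uP.
have hx : h != x by apply: hP; rewrite Pxy !inE eqxx.
have hy : h != y by apply: hP; rewrite Pxy !inE eqxx orbT.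
have cx : e c x by case/and4P: legx => _ /andP[].
have cy : e c y by case/and4P: legy => _ /andP[].
have ch : e c h by case/andP: pl.
have nbr u : e c u -> u \in [:: h; x; y].
  move=> cu; apply/negPn/negP; rewrite !inE !negb_or => /and3P[uh ux uy].
  have := @size_neighbours c [:: u; h; x; y].
  rewrite c3 /= !inE !negb_or uh ux uy hx hy xy cu cx cy ch.
  by move=> /(_ isT isT).
have cl v u : v \in h :: t -> e v u -> u \in [:: c, h & t].
  apply: leg_closed => //; last by case/and4P: legl => _ _ _ /eqP.
  move=> w wt; apply: deg; apply: contraTneq wt => ->; by case/andP: ul.
have notin u : e c u -> h != u -> u \notin h :: t.
  move=> cu hu; apply: contra hu => ut.
  by rewrite (acyclic_chord acy sym pl ul ut cu).
have unq : uniq [:: x, y, c, h & t].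
  have out u : e c u -> h != u -> u \notin c :: h :: t.
    move=> cu hu; rewrite in_cons negb_or notin // andbT.
    by apply: contraTneq cu => ->; rewrite irr.
  by rewrite 2!cons_uniq ul in_cons (negPf xy) !out.
(* The listed vertices are closed under adjacency, hence exhaust [V] by connectedness. *)
have full v : v \in [set u in [:: x, y, c, h & t]].
  have leaf u w : u \in pendant_neighbours c -> e u w -> w = c.
    rewrite !inE => /andP[/eqP d1 uc] uw; apply/eqP/negPn/negP => wc.
    have := @size_neighbours u [:: w; c].
    by rewrite d1 /= inE wc uw uc => /(_ isT isT).
  apply: (connected_closed (x := c) con); first by rewrite !inE eqxx !orbT.
  move=> {}v u; rewrite ![_ \in [set _ in _]]inE.
  rewrite in_cons => /orP[/eqP -> /leaf ->|].
  - by rewrite !inE eqxx !orbT.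
  - by rewrite Pxy !inE eqxx.
  rewrite in_cons => /orP[/eqP -> /leaf ->|].
  - by rewrite !inE eqxx !orbT.
  - by rewrite Pxy !inE eqxx orbT.
  rewrite in_cons => /orP[/eqP -> /nbr|/cl vt /vt].
    by rewrite !inE => /or3P[] ->; rewrite ?orbT.
  by move=> ut; rewrite 2!inE ut !orbT.
have sz : size (h :: t) = (#|V| - 3)%N.
  have -> : #|V| = size [:: x, y, c, h & t].
    rewrite -(card_uniqP unq); apply: eq_card => v.
    by have := full v; rewrite inE => ->.
  by rewrite /= !subSS subn0.
exists c, [:: [:: x]; [:: y]; h :: t]; split.
- rewrite /= !inE negb_or !eqseq_cons.
  by rewrite (negPf xy) (eq_sym x) (eq_sym y) (negPf hx) (negPf hy).
(* A leg starts at a neighbour of [c], that is at [h], [x] or [y], and its first vertex determines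
   it. *)
- move=> l; rewrite !inE; apply/or3P/idP => [[]/eqP ->|] //.
  case: l => [|w l] legl'; first by case/and4P: legl' => _ _ _; rewrite /= c3.
  have : e c w by case/and4P: legl' => _ /andP[].
  move=> /nbr; rewrite !inE => /or3P[]/eqP wE; rewrite wE in legl' *.
  + by apply: Or33; rewrite (unique _ _ _ legl legl').
  + by apply: Or31; rewrite -(unique _ _ _ legx legl').
  + by apply: Or32; rewrite -(unique _ _ _ legy legl').
- by rewrite /= -sz.
Qed.

End Graph.

(** * Edge weights and the irregularity sum *)

Section Weights.
Variables (R : realType) (V : finType) (e : rel V).

(** Swapping the coordinates exchanges the two halves cut out by [r], and the diagonal contributes
    0. *)
Lemma sum_symmetric (r : V -> nat) (F : V -> V -> R) : injective r ->
  (forall u v, F u v = F v u) -> (forall u, F u u = 0) ->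
  \sum_u \sum_v F u v = 2 * \sum_(uv : V * V | (r uv.1 < r uv.2)%N) F uv.1 uv.2.
Proof.
move=> r_inj Fsym F0; rewrite pair_big /=.
rewrite (bigID (fun uv : V * V => (r uv.1 < r uv.2)%N)) /= mulr2n mulrDl !mul1r.
congr (_ + _); rewrite (reindex_inj (h := fun uv : V * V => (uv.2, uv.1))) /=.
  rewrite (bigID (fun uv : V * V => uv.1 == uv.2)) /= big1 ?add0r; last first.
    by move=> [u v] /= /andP[_ /eqP ->].
  apply: eq_big => [[u v]|[u v] _] /=; last exact: Fsym.
  rewrite -leqNgt ltn_neqAle andbC; congr (_ && _).
  by rewrite (inj_eq r_inj).
by move=> [u v] [u' v'] [-> ->].
Qed.

Lemma sum_darts (A B : {set V}) :
  \sum_u \sum_v (e u v)%:R * ((u \in A)%:R * (v \in B)%:R) =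
  (darts e A B)%:R :> R.
Proof.
rewrite /darts natr_sum [RHS]big_mkcond; apply: eq_bigr => u _ /=.
case: (u \in A); last by apply: big1 => v _; rewrite mul0r mulr0.
rewrite natr_sum [RHS]big_mkcond; apply: eq_bigr => v _ /=.
by case: (v \in B); rewrite ?mulr1 ?mulr0.
Qed.

(* The lower bound for the contribution of an edge whose ends have degrees d
   and d', where t stands for 2^p: t, 1, 1 on the edges of type L-B, L-M, M-B
   and 0 on the others. *)
Definition class_weight (t : R) (d d' : nat) : R :=
  t * ((d == 1%N)%:R * (2 < d')%N%:R + (2 < d)%N%:R * (d' == 1%N)%:R)
  + ((d == 1%N)%:R * (d' == 2%N)%:R + (d == 2%N)%:R * (d' == 1%N)%:R)
  + ((d == 2%N)%:R * (2 < d')%N%:R + (2 < d)%N%:R * (d' == 2%N)%:R).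

Lemma class_weightC (t : R) (d d' : nat) : class_weight t d d' = class_weight t d' d.
Proof. rewrite /class_weight; ring. Qed.

(** The degrees differ by at least 2 on the L-B type and by at least 1 on the L-M and M-B types, and
    the power is monotone. *)
Lemma class_weight_le (p : R) (d d' : nat) : 0 < p -> (0 < d)%N -> (0 < d')%N ->
  class_weight (2 `^ p) d d' <= `|d%:R - d'%:R| `^ p.
Proof.
move=> p0; wlog dd : d d' / (d <= d')%N => [H d0 d'0|].
  have [|/ltnW] := leqP d d'; first by move/H; apply.
  by rewrite class_weightC distrC => /H; apply.
move=> d0 d'0; rewrite distrC -natrB // ger0_norm ?ler0n //.
have mono (k : nat) : (k <= d' - d)%N -> k%:R `^ p <= (d' - d)%:R `^ p :> R.
  by move=> le; apply: ge0_ler_powR; rewrite ?nnegrE ?ler0n ?ler_nat // ltW.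
have m0 : 0 <= (d' - d)%:R `^ p :> R by apply: powR_ge0.
case: d d' d0 d'0 dd mono m0 => [|[|[|d]]] // [|[|[|d']]] // _ _ dd mono m0;
  rewrite /class_weight /= ?(mulr0, mul0r, mulr1, addr0, add0r) //.
- by have := mono 1%N isT; rewrite powR1.
- exact: mono 2%N isT.
- by have := mono 1%N; rewrite powR1; apply; lia.
Qed.

(** With degrees at most 3 the differences are exactly 2, 1, 1 and 0, and [0 < p] makes the power of
    0 vanish. *)
Lemma class_weight_eq (p : R) (d d' : nat) : 0 < p ->
  (0 < d <= 3)%N -> (0 < d' <= 3)%N ->
  `|d%:R - d'%:R| `^ p = class_weight (2 `^ p) d d'.
Proof.
move=> p0; wlog dd : d d' / (d <= d')%N => [H d0 d'0|].
  have [|/ltnW] := leqP d d'; first by move/H; apply.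
  by rewrite class_weightC distrC => /H; apply.
rewrite distrC -natrB // ger0_norm ?ler0n //.
case: d d' dd => [|[|[|[|d]]]] // [|[|[|[|d']]]] // _ _ _;
  rewrite /class_weight /= ?(mulr0, mul0r, mulr1, addr0, add0r) // ?subnn;
  by rewrite ?powR1 ?powR0 // gt_eqF.
Qed.

Lemma sum_class_weight (t : R) : symmetric e ->
  \sum_u \sum_v (e u v)%:R * class_weight t (degree e u) (degree e v) =
  2 * (t * (darts e (degree_class e 1) (branching e))%:R
       + (darts e (degree_class e 1) (degree_class e 2))%:R
       + (darts e (degree_class e 2) (branching e))%:R).
Proof.
move=> sym; pose X (A B : {set V}) u v : R :=
  (e u v)%:R * ((u \in A)%:R * (v \in B)%:R).
set L := degree_class e 1; set M := degree_class e 2; set B := branching e.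
(* Each product of degree indicators becomes a sum over a pair of classes; symmetry merges the two
   orientations into the factor 2. *)
transitivity (\sum_u \sum_v (t * (X L B u v + X B L u v)
    + (X L M u v + X M L u v) + (X M B u v + X B M u v))).
  apply: eq_bigr => u _; apply: eq_bigr => v _.
  rewrite /X /class_weight !inE; ring.
under eq_bigr do rewrite !big_split -mulr_sumr big_split /=.
rewrite !big_split -mulr_sumr big_split /= !sum_darts.
by rewrite (dartsC B L sym) (dartsC M L sym) (dartsC B M sym); ring.
Qed.

(** The sum under the root in [albertson], that is A_p^p. *)
Definition irregularity_sum (p : R) : R :=
  \sum_(uv : V * V | e uv.1 uv.2 && (enum_rank uv.1 < enum_rank uv.2)%N)
    `|(degree e uv.1)%:R - (degree e uv.2)%:R| `^ p.

Lemma irregularity_sumE (p : R) : simple_graph e -> 2 * irregularity_sum p =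
  \sum_u \sum_v (e u v)%:R * `|(degree e u)%:R - (degree e v)%:R| `^ p.
Proof.
move=> [sym irr]; rewrite (sum_symmetric (r := enum_rank)).
- congr (2 * _); rewrite /irregularity_sum big_mkcondl /=.
  by apply: eq_bigr => [[u v]] _ /=; case: (e u v); rewrite ?mul1r ?mul0r.
- by move=> u v /ord_inj/enum_rank_inj.
- by move=> u v; rewrite sym distrC.
- by move=> u; rewrite irr mul0r.
Qed.

Lemma irregularity_sum_ge (p : R) : 0 < p -> simple_graph e ->
  (forall v, 0 < degree e v)%N ->
  2 `^ p * (darts e (degree_class e 1) (branching e))%:R
    + (darts e (degree_class e 1) (degree_class e 2))%:R
    + (darts e (degree_class e 2) (branching e))%:R <= irregularity_sum p.
Proof.
move=> p0 gr gt0; rewrite -(ler_pM2l (ltr0n R 2)) irregularity_sumE //.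
rewrite -sum_class_weight; last by case: gr.
apply: ler_sum => u _; apply: ler_sum => v _.
by apply: ler_wpM2l; [exact: ler0n | exact: class_weight_le].
Qed.

Lemma irregularity_sum_eq (p : R) : 0 < p -> simple_graph e ->
  (forall v, 0 < degree e v <= 3)%N ->
  irregularity_sum p =
  2 `^ p * (darts e (degree_class e 1) (branching e))%:R
    + (darts e (degree_class e 1) (degree_class e 2))%:R
    + (darts e (degree_class e 2) (branching e))%:R.
Proof.
move=> p0 gr deg; apply: (mulfI (x := 2)); first by rewrite pnatr_eq0.
rewrite irregularity_sumE // -sum_class_weight; last by case: gr.
by apply: eq_bigr => u _; apply: eq_bigr => v _; rewrite class_weight_eq.
Qed.

Lemma powR_root_le (p x y : R) : 0 < p -> 0 <= x -> x <= y ->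
  x `^ (1 / p) <= y `^ (1 / p).
Proof.
move=> p0 x0 xy; apply: ge0_ler_powR => //.
- by rewrite divr_ge0 // ltW.
- by rewrite nnegrE (le_trans x0).
Qed.

Lemma powR_root_eq (p x y : R) : 0 < p -> 0 <= x -> 0 <= y ->
  x `^ (1 / p) = y `^ (1 / p) <-> x = y.
Proof.
move=> p0 x0 y0; split=> [|->//].
by apply: powR_injective; rewrite ?nnegrE ?divr_gt0.
Qed.

End Weights.

(** * Spiders against all other trees, and the comparison of 2^p with 2 *)

(** Here [a] counts the L-B edges and [b] the L-M edges, with [a + b] the number of leaves; the M-B
    edges, at least [b] in number, account for the factor 2. *)
Lemma irregularity_dichotomy (R : realType) (n : nat) (V : finType)
    (e : rel V) (p : R) : (10 <= n)%N -> #|V| = n -> is_tree e ->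
  ~ graph_iso e (@path_graph n) -> 0 < p ->
  (exists c a, [/\ is_spider3 e, branching e = [set c], degree e c = 3%N,
     darts e (degree_class e 1) (branching e) = a
     & (a <= 2)%N /\ irregularity_sum e p = 2 `^ p * a%:R + 2 * (3 - a%:R)])
  \/ (~ is_spider3 e /\ exists a b, (4 <= a + b)%N /\
     2 `^ p * a%:R + 2 * b%:R <= irregularity_sum e p).
Proof.
move=> hn hV he hP hp.
have [b bB] := not_path_branching he hV hP.
have [[sym irr] con acy] := he.
have gt0 v : (0 < degree e v)%N.
  by apply: connected_degree_gt0 con _; rewrite hV; lia.
have [L3 spL] := spider3_leaves he bB.
have [cV cL bd bc Bd c2] := tree_countsP he bB.
have [sp|nsp] := pselect (is_spider3 e); last first.
  right; split=> //.
  exists (darts e (degree_class e 1) (branching e)).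
  exists (darts e (degree_class e 1) (degree_class e 2)).
  have nL3 : #|degree_class e 1| <> 3%N by move/spL.2.
  split; first by lia.
  apply: le_trans (irregularity_sum_ge hp _ gt0); last by split.
  move: bc; rewrite -(ler_nat R) => bc; lra.
left; have [c [cB c3]] := (spider3P he).1 sp.
move/spL.1: (sp) => {}L3.
exists c, (darts e (degree_class e 1) (branching e)).
rewrite {1}cB big_set1 c3 in Bd.
(* Three leaves and degree 3 at [c] give L-M = M-B + B-B as dart counts, and [bc] then forces
   equality of the first two. *)
have cb : darts e (degree_class e 2) (branching e) =
  darts e (degree_class e 1) (degree_class e 2) by lia.
split=> //; split.
  (* If [M] is empty, [n] is 4. Otherwise the forest bound on [M] yields an L-M edge, so [a] is not
     3. *)
  have [M0|] := posnP #|degree_class e 2|.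
    by rewrite cB cards1 in cV; lia.
  move=> /card_gt0P[m mM]; have := darts_forest acy sym irr mM; lia.
have deg v : (0 < degree e v <= 3)%N.
  rewrite gt0 /=; have [vc|] := boolP (v \in branching e).
    by move: vc; rewrite cB => /set1P ->; rewrite c3.
  by rewrite inE -leqNgt => /leq_trans; apply.
have dE : (darts e (degree_class e 1) (degree_class e 2))%:R =
    3 - (darts e (degree_class e 1) (branching e))%:R :> R.
  by apply/eqP; rewrite eq_sym subr_eq -natrD eqr_nat; apply/eqP; lia.
by rewrite (irregularity_sum_eq hp (conj sym irr) deg) cb dE; ring.
Qed.

Theorem theorem4p2 (R : realType) (n : nat) (hn : (10 <= n)%N)
    (V : finType) (hV : #|V| = n) (e : rel V) (he : is_tree e)
    (hP : ~ graph_iso e (@path_graph n)) (p : R) (hp : 0 < p) :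
  [/\ 1 < p ->
        6 `^ (1 / p) <= albertson e p /\
        (albertson e p = 6 `^ (1 / p) <->
         is_spider3 e /\
         forall (c : V) (l : seq V), is_leg e c l -> (2 <= size l)%N),
      p = 1 ->
        6 <= albertson e p /\
        (albertson e p = 6 <-> is_spider3 e)
    & p < 1 ->
        (2 `^ (p + 1) + 2) `^ (1 / p) <= albertson e p /\
        (albertson e p = (2 `^ (p + 1) + 2) `^ (1 / p) <->
         is_spider3 e /\ leg_lengths e [:: 1%N; 1%N; (n - 3)%N])].
Proof.
have [[sym irr] _ _] := he.
have S0 : 0 <= irregularity_sum e p by apply: sumr_ge0 => uv _; apply: powR_ge0.
have -> : albertson e p = irregularity_sum e p `^ (1 / p) by [].
have powlt (q r : R) : q < r -> 2 `^ q < 2 `^ r :> R.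
  by move=> qr; rewrite /powR pnatr_eq0 /= ltr_expR ltr_pM2r ?ln_gt0 ?ltr1n.
have cases := irregularity_dichotomy hn hV he hP hp.
split=> [p1|p1|p1].
- have t2 : 2 < 2 `^ p :> R by rewrite -{1}(powRr1 (ler0n R 2)) powlt.
  suff [S6 Seq] : 6 <= irregularity_sum e p /\ (irregularity_sum e p = 6 <->
      is_spider3 e /\ forall c l, is_leg e c l -> (2 <= size l)%N).
    by split; [exact: powR_root_le | rewrite powR_root_eq].
  (* For spiders the sum is 6 + (2^p - 2)a, equal to 6 only if [a] is 0; otherwise it is at least
     2(a + b) >= 8. *)
  case: cases => [[c [a [sp cB c3 aE [a2 ->]]]]|[nsp [a [b [ab le]]]]].
    rewrite (legs_ge2P sym irr cB c3) aE.
    have aR : 0 <= a%:R :> R by exact: ler0n.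
    split; first by nra.
    split=> [E|[_ ->]]; last by rewrite mulr0; ring.
    split=> //; apply/eqP; rewrite -(pnatr_eq0 R); apply/eqP; nra.
  have aR : 0 <= a%:R :> R by exact: ler0n.
  have abR : 4 <= a%:R + b%:R :> R by rewrite -natrD ler_nat.
  have lt : 6 < irregularity_sum e p by nra.
  by split; [exact: ltW | split=> [E|[]//]; rewrite E ltxx in lt].
- rewrite p1 in cases *; rewrite divr1 powRr1 -?p1 //.
  rewrite powRr1 ?ler0n // in cases.
  case: cases => [[c [a [sp _ _ _ [_]]]]|[nsp [a [b [ab]]]]].
    by rewrite p1 => ->; split; [lra | split=> // _; ring].
  have abR : 4 <= a%:R + b%:R :> R by rewrite -natrD ler_nat.
  rewrite p1 => le; have lt : 6 < irregularity_sum e (1 : R) by lra.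
  by split; [exact: ltW | split=> // E; rewrite E ltxx in lt].
have t1 : 1 < 2 `^ p :> R by rewrite -{1}(powRr0 2) powlt.
have t2 : 2 `^ p < 2 :> R by rewrite -{2}(powRr1 (ler0n R 2)) powlt.
have tE : 2 `^ (p + 1) = 2 `^ p * 2 :> R.
  by rewrite powRD ?powRr1 ?ler0n // gt_eqF ?implybT // addr_gt0.
rewrite tE.
suff [SK Seq] : 2 `^ p * 2 + 2 <= irregularity_sum e p /\
    (irregularity_sum e p = 2 `^ p * 2 + 2 <->
      is_spider3 e /\ leg_lengths e [:: 1%N; 1%N; (n - 3)%N]).
  have K0 : 0 <= 2 `^ p * 2 + 2 :> R by lra.
  by split; [exact: powR_root_le | rewrite powR_root_eq].
(* For spiders the sum is 6 - (2 - 2^p)a, smallest at the largest value [a] = 2; otherwise it is at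
   least 4 * 2^p, which exceeds 2 * 2^p + 2 because 2^p > 1. *)
case: cases => [[c [a [sp cB c3 aE [a2 ->]]]]|[nsp [a [b [ab le]]]]]; last first.
  have bR : 0 <= b%:R :> R by exact: ler0n.
  have abR : 4 <= a%:R + b%:R :> R by rewrite -natrD ler_nat.
  have lt : 2 `^ p * 2 + 2 < irregularity_sum e p by nra.
  by split; [exact: ltW | split=> [E|[]//]; rewrite E ltxx in lt].
have a2P : leg_lengths e [:: 1%N; 1%N; (n - 3)%N] <-> a = 2%N.
  rewrite -aE (card_pendant_neighbours cB); split.
    by apply: leg_lengths_pendant => //; lia.
  have [b bB] : exists b, b \in branching e by exists c; rewrite cB inE.
  rewrite -hV; apply: pendant_leg_lengths => //.
  by apply/(spider3_leaves he bB).2.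
rewrite a2P; case: a a2 {aE a2P} => [|[|[|//]]] _.
- by split; [lra | split=> [/eqP|[]//]; rewrite gt_eqF //; lra].
- by split; [lra | split=> [/eqP|[]//]; rewrite gt_eqF //; lra].
- by split; [lra | split=> // _; lra].
Qed.
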